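(* Fix $s,t\in\mathbb{N}$ and let $\mathcal{G}$ be a minor-closed class such that every graph with treewidth at most $s$ is in $\mathcal{G}$ and $K_{s+1,t}\notin\mathcal{G}$. Then for every fixed forest $T$, $$C(T,\mathcal{G},n)\in\Theta(n^{\alpha_s(T)})\quad (n\to\infty).$$
   Context: All graphs are finite, simple and undirected. A graph class $\mathcal{G}$ is minor-closed if some graph is not in $\mathcal{G}$ and every minor of every graph in $\mathcal{G}$ is in $\mathcal{G}$. For graphs $H,G$, $C(H,G)$ denotes the number of subgraphs of $G$ isomorphic to $H$. For a graph class $\mathcal{G}$, $C(H,\mathcal{G},n):=\max\{C(H,G): G\in\mathcal{G},\ |V(G)|=n\}$. For a graph $G$ and $s\in\mathbb{N}_0$, $\alpha_s(G)$ is the maximum size of a stable set in the subgraph of $G$ induced by the vertices of degree at most $s$ in $G$. $\Theta(n^a)$ means bounded above and below by positive constant multiples of $n^a$ for all sufficiently large $n$ (constants depending on $T$ and $\mathcal{G}$). *)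

(* Defs.v *)
From mathcomp Require Import all_boot.
From mathcomp Require Import boolp classical_sets.

Set Implicit Arguments.
Unset Strict Implicit.
Unset Printing Implicit Defensive.

Record sgraph := SGraph {
  vertex :> finType;
  adj : rel vertex;
  adj_sym : symmetric adj;
  adj_irrefl : irreflexive adj }.

Definition graph_class := sgraph -> Prop.

Definition edges (G : sgraph) : {set {set G}} :=
  [set [set p.1; p.2] | p : G * G & adj p.1 p.2].

Definition degree (G : sgraph) (x : G) : nat := #|[set y | adj x y]|.

Definition isomorphic (G H : sgraph) : Prop :=
  exists2 f : G -> H, bijective f & forall x y, adj (f x) (f y) = adj x y.

Section Induced.
Variables (G : sgraph) (A : {set G}).

Definition induced_adj : rel {x : G | x \in A} :=
  fun x y => adj (val x) (val y).

Lemma induced_sym : symmetric induced_adj.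
Proof. by move=> x y; apply: adj_sym. Qed.

Lemma induced_irrefl : irreflexive induced_adj.
Proof. by move=> x; apply: adj_irrefl. Qed.

Definition induced : sgraph := SGraph induced_sym induced_irrefl.
End Induced.

(* A subgraph of G is a pair (vertex set, edge set), not up to isomorphism. *)
Definition is_subgraph (G : sgraph) (S : {set G} * {set {set G}}) : bool :=
  (S.2 \subset edges G) && [forall e in S.2, e \subset S.1].

Section SubgraphGraph.
Variables (G : sgraph) (S : {set G} * {set {set G}}).

(* The test val x != val y is redundant when is_subgraph S holds; it makes the
   relation irreflexive for every S. *)
Definition subgraph_adj : rel {x : G | x \in S.1} :=
  fun x y => (val x != val y) && ([set val x; val y] \in S.2).

Lemma subgraph_sym : symmetric subgraph_adj.
Proof. by move=> x y; rewrite /subgraph_adj eq_sym finset.setUC. Qed.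

Lemma subgraph_irrefl : irreflexive subgraph_adj.
Proof. by move=> x; rewrite /subgraph_adj eqxx. Qed.

Definition subgraph_graph : sgraph := SGraph subgraph_sym subgraph_irrefl.
End SubgraphGraph.

Definition copies (H G : sgraph) : nat :=
  #|[set S : {set G} * {set {set G}} |
      is_subgraph S && `[< isomorphic (subgraph_graph S) H >]]|.

Definition is_max_copies (H : sgraph) (C : graph_class) (n m : nat) : Prop :=
  (exists G : sgraph, [/\ C G, #|G| = n & copies H G = m]) /\
  (forall G : sgraph, C G -> #|G| = n -> copies H G <= m).

(* The maximum exists as soon as C contains a graph with n vertices, see
   max_copiesP; otherwise the value is 0. *)
Definition max_copies (H : sgraph) (C : graph_class) (n : nat) : nat :=
  xget 0 (is_max_copies H C n).

Lemma copies_bound (H G : sgraph) :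
  copies H G <= 2 ^ #|G| * 2 ^ (2 ^ #|G|).
Proof.
apply: leq_trans (max_card _) _.
have cset (T : finType) : #|{set T}| = 2 ^ #|T|.
  by rewrite -(cardsT {set T}) -powersetT card_powerset cardsT.
by rewrite card_prod !cset.
Qed.

Lemma max_copiesP (H : sgraph) (C : graph_class) (n : nat) :
  (exists2 G : sgraph, C G & #|G| = n) ->
  is_max_copies H C n (max_copies H C n).
Proof.
move=> [G0 CG0 nG0]; apply: xgetPex.
pose P m := `[< exists G : sgraph, [/\ C G, #|G| = n & copies H G = m] >].
have exP : exists m, P m.
  by exists (copies H G0); apply/asboolP; exists G0.
have ubP m : P m -> m <= 2 ^ n * 2 ^ (2 ^ n).
  by move=> /asboolP [G [_ <- <-]]; apply: copies_bound.
have [m /asboolP Pm mmax] := ex_maxnP exP ubP.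
exists m; split=> // G CG nG.
by apply: mmax; apply/asboolP; exists G.
Qed.

Definition is_connected (G : sgraph) : Prop :=
  0 < #|G| /\ forall x y : G, connect (@adj G) x y.

(* ucycle accepts sequences x, y with x adjacent to y, which are not cycles of a
   simple graph; hence the bound 3. *)
Definition is_forest (G : sgraph) : Prop :=
  forall c : seq G, ucycle (@adj G) c -> size c < 3.

Definition is_tree (G : sgraph) : Prop := is_connected G /\ is_forest G.

(* H is a minor of G: the sets B x are the branch sets, contracted to the
   vertices x of H; vertices outside them and surplus edges are deleted. *)
Definition is_minor (H G : sgraph) : Prop :=
  exists B : H -> {set G},
    [/\ forall x, is_connected (induced (B x)),
        forall x y, x != y -> [disjoint B x & B y] &
        forall x y, adj x y ->
          exists u v, [/\ u \in B x, v \in B y & adj u v]].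

Definition minor_closed (C : graph_class) : Prop :=
  (exists G, ~ C G) /\ (forall G H, C G -> is_minor H G -> C H).

Record tree_decomposition (G D : sgraph) (B : D -> {set G}) : Prop := {
  td_tree : is_tree D;
  td_vertex : forall x : G, is_connected (induced [set d | x \in B d]);
  td_edge : forall x y : G, adj x y -> exists d, (x \in B d) && (y \in B d) }.

(* The treewidth is the minimum, over all tree decompositions, of the maximum
   bag size minus 1. *)
Definition treewidth_at_most (G : sgraph) (k : nat) : Prop :=
  exists (D : sgraph) (B : D -> {set G}),
    tree_decomposition B /\ forall d, #|B d| <= k.+1.

Section CompleteBipartite.
Variables a b : nat.

Definition Kbip_adj : rel ('I_a + 'I_b)%type :=
  fun x y => match x, y with
             | inl _, inr _ | inr _, inl _ => true
             | _, _ => false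
             end.

Lemma Kbip_sym : symmetric Kbip_adj.
Proof. by move=> [i|i] [j|j]. Qed.

Lemma Kbip_irrefl : irreflexive Kbip_adj.
Proof. by move=> [i|i]. Qed.

Definition complete_bipartite : sgraph := SGraph Kbip_sym Kbip_irrefl.
End CompleteBipartite.

Definition stable (G : sgraph) (A : {set G}) : bool :=
  [forall x in A, forall y in A, ~~ adj x y].

Definition stability_number (G : sgraph) : nat :=
  \max_(A : {set G} | stable A) #|A|.

Definition alpha_low (s : nat) (G : sgraph) : nat :=
  stability_number (induced [set x : G | degree x <= s]).

(* Main.v *)
Require Import Defs.
From mathcomp Require Import all_boot boolp zify.

(* Let L be the set of vertices of degree at most s in T.

   Lower bound: replacing every vertex of a maximum stable set S of T[L] by
   about n / |S| copies with the same (at most s) neighbours creates a graph of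
   treewidth at most s with on the order of n^|S| copies of T.

   Upper bound: a graph G in the class has no clique minor of order s + 1 + t,
   hence O(n) edges. By Koenig duality, L is covered by alpha_s(T) edges and
   single vertices of T, so embeddings of T into G restrict to L in
   O(n^alpha_s(T)) ways. If too many embeddings had the same restriction, a
   sunflower argument would give t of them that agree on some J with
   L <= J < V(T) and have disjoint images outside J. A component K of T - J has
   k vertices, all of degree at least s + 1, and spans k - 1 edges, hence has at
   least (s + 1) k - 2 (k - 1) >= s + 1 neighbours, all distinct because T is a
   forest and all in J. The t images of K, contracted, together with the common
   images of s + 1 of these neighbours form a K_{s+1,t} minor of G. *)

Set Implicit Arguments.
Unset Strict Implicit.
Unset Printing Implicit Defensive.

(** * Connected vertex sets *)

Section ConnectedSets.
Variable G : sgraph.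
Implicit Types (A B : {set G}) (x y z : G).

(** Walks inside [A] run through vertices of [G] itself, which avoids the subtype behind [induced];
    [is_connected_induced] reconciles the two notions. *)
Definition adj_in A : rel G := fun x y => [&& x \in A, y \in A & adj x y].

Definition connected_set A :=
  exists2 x, x \in A & forall y, y \in A -> connect (adj_in A) x y.

Lemma adj_in_sym A : symmetric (adj_in A).
Proof. by move=> x y; rewrite /adj_in adj_sym andbCA. Qed.

Lemma connect_adj_in_sym A : connect_sym (adj_in A).
Proof. exact/sym_connect_sym/adj_in_sym. Qed.

Lemma connected_setP A :
  connected_set A <->
  A != set0 /\ {in A &, forall x y, connect (adj_in A) x y}.
Proof.
split=> [[x Ax cx] | [/set0Pn[x Ax] cA]]; last first.
  by exists x => // y Ay; apply: cA.
split; first by apply/set0Pn; exists x.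
move=> y z Ay Az; apply: connect_trans (cx z Az).
by rewrite connect_adj_in_sym; apply: cx.
Qed.

Lemma sub_connect (e e' : rel G) x y :
  subrel e e' -> connect e x y -> connect e' x y.
Proof. by move=> see'; apply: connect_sub => u v /see'/connect1. Qed.

Lemma adj_inS A B : A \subset B -> subrel (adj_in A) (adj_in B).
Proof. by move=> /subsetP AB x y /and3P[/AB xB /AB yB xy]; apply/and3P. Qed.

Lemma connect_adj_in_mem A x y :
  connect (adj_in A) x y -> x \in A -> y \in A.
Proof.
move=> cxy Ax.
have clA : closed (adj_in A) A by move=> u v /and3P[-> ->].
by rewrite -(closed_connect clA cxy).
Qed.

Lemma is_connected_induced A : is_connected (induced A) <-> connected_set A.
Proof.
split=> [[/card_gt0P[[x Ax] _] cA] | /connected_setP[/set0Pn[x Ax] cA]].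
  exists x => // y Ay.
  have /connectP[p pp yE] := cA (exist _ x Ax) (exist _ y Ay).
  rewrite -[x]/(val (exist (fun z => z \in A) x Ax)).
  rewrite -[y]/(val (exist (fun z => z \in A) y Ay)) yE.
  elim: p (exist _ x Ax) pp {yE} => [|z p IHp] u //= /andP[uz pz].
  by apply: connect_trans (IHp _ pz); apply/connect1/and3P; split=> //; apply: valP.
split=> [|[y Ay] [z Az]]; first by apply/card_gt0P; exists (Sub x Ax).
have /connectP[p pp zE] := cA y z Ay Az.
elim: p y Ay pp zE => [|u p IHp] y Ay /=.
  by move=> _ zy; rewrite (_ : exist _ z Az = exist _ y Ay) ?connect0 //; apply: val_inj.
move=> /andP[/and3P[_ Au yu] pp] zE.
by apply: connect_trans (IHp u Au pp zE); apply: connect1.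
Qed.

Lemma connected_set1 x : connected_set [set x].
Proof. by exists x => [|y /set1P->]; rewrite ?set11. Qed.

Lemma connected_setU1 A x y :
  connected_set A -> x \in A -> adj x y -> connected_set (y |: A).
Proof.
move=> /connected_setP[_ cA] Ax xy; exists x; first by rewrite !inE Ax orbT.
have sub : subrel (adj_in A) (adj_in (y |: A)) by apply/adj_inS/subsetUr.
move=> z /setU1P[->|Az]; last exact: sub_connect (cA x z Ax Az).
by apply/connect1/and3P; rewrite !inE Ax eqxx orbT.
Qed.

Lemma connected_set_component A x :
  x \in A -> connected_set [set y | connect (adj_in A) x y].
Proof.
move=> Ax; exists x; first by rewrite inE.
move=> y; rewrite inE => /connectP[p pp ->].
suff aux u : path (adj_in A) u p -> connect (adj_in A) x u ->
    connect (adj_in [set y | connect (adj_in A) x y]) u (last u p) by apply: aux.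
elim: p u {pp} => [|z p IHp] u //= /andP[uz pp] xu.
have xz : connect (adj_in A) x z by apply: connect_trans xu (connect1 uz).
apply: connect_trans (IHp z pp xz); apply: connect1.
by rewrite /adj_in !inE xu xz /=; case/and3P: uz.
Qed.

Lemma connected_set_exit A B x :
  connected_set A -> B \subset A -> x \in B -> B != A ->
  exists u v, [/\ u \in B, v \in A :\: B & adj u v].
Proof.
move=> /connected_setP[_ cA] sBA Bx neqBA.
have /subsetPn[y Ay nBy] : ~~ (A \subset B) by rewrite eqEsubset sBA in neqBA.
have /connectP[p pp yE] := cA x y (subsetP sBA _ Bx) Ay.
elim: p x Bx pp yE => [|z p IHp] x Bx /=; first by move=> _ yE; rewrite yE Bx in nBy.
move=> /andP[/and3P[_ Az xz] pp yE].
case: (boolP (z \in B)) => [Bz | nBz]; first exact: IHp Bz pp yE.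
by exists x, z; split=> //; rewrite inE nBz.
Qed.

End ConnectedSets.

Lemma connected_set_imset (G H : sgraph) (f : G -> H) (A : {set G}) :
  {homo f : x y / adj x y} -> connected_set A -> connected_set (f @: A).
Proof.
move=> homf [x Ax cA]; exists (f x); first exact: imset_f.
move=> _ /imsetP[y Ay ->]; have /connectP[p pp ->] := cA y Ay.
elim: p x pp {cA Ax Ay} => [|z p IHp] x //= /andP[/and3P[Ax Az xz] pp].
by apply: connect_trans (IHp z pp); apply/connect1/and3P; split; rewrite ?imset_f ?homf.
Qed.

(** * Forests *)

Section Forests.
Variable T : sgraph.
Hypothesis T_forest : is_forest T.
Implicit Types (A K : {set T}) (x y z : T).

(** A simple path from [a] to [b] in [K], closed up through [y], would be a cycle of length at least
    3 if [a] and [b] differed. *)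
Lemma forest_connected_neighbor K y a b :
  connected_set K -> y \notin K -> a \in K -> b \in K ->
  adj y a -> adj y b -> a = b.
Proof.
move=> /connected_setP[_ cK] nKy Ka Kb ya yb.
have /connectP[p0 pp0 bE] := cK a b Ka Kb.
case/shortenP: pp0 bE => p pp up _ bE.
have pK : {subset a :: p <= K}.
  elim: p a Ka pp {p0 cK ya bE up} => [|z p IHp] a Ka /=.
    by move=> _ u; rewrite inE => /eqP->.
  move=> /andP[/and3P[_ Kz _] pp] u; rewrite inE => /predU1P[-> //|].
  exact: IHp Kz pp u.
have adjp : path (@adj T) a p.
  by apply: sub_path pp => u v /and3P[].
have := T_forest (c := y :: a :: p).
rewrite /ucycle [cycle _ _]/= ya rcons_path adjp -bE adj_sym yb [uniq _]/=.
rewrite -[in _ && _ && _]/(uniq (a :: p)) up andbT.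
have -> /= : y \notin a :: p by apply/negP => /pK; apply/negP.
by case: p bE {pp up pK adjp} => [->|z p] //= _ /(_ isT).
Qed.

(** Grow a connected set from [x] vertex by vertex; just before it fills [A], it is the desired
    [K]. *)
Lemma connected_set_remove A x : connected_set A -> x \in A -> A != [set x] ->
  exists K y, [/\ connected_set K, y \notin K & A = y |: K].
Proof.
move=> cA Ax A1.
have: exists2 K : {set T}, connected_set K & [/\ x \in K, K \subset A & K != A].
  by exists [set x]; [apply: connected_set1 | rewrite set11 sub1set Ax eq_sym].
case=> K; elim: {K}_.+1 {-2}K (ltnSn #|A :\: K|) => // n IHn K leKn cK [Kx sKA KA].
have [u [v [Ku /setDP[Av nKv] uv]]] := connected_set_exit cA sKA Kx KA.
have [vKA | vKA] := eqVneq (v |: K) A; first by exists K, v.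
apply: IHn (connected_setU1 cK Ku uv) _.
  apply: leq_trans (_ : #|A :\: K| <= n) => //; apply: proper_card.
  rewrite properE setDS ?subsetUr //=; apply/subsetPn; exists v; first by rewrite inE nKv.
  by rewrite !inE eqxx.
by rewrite inE Kx orbT subUset sub1set Av sKA vKA.
Qed.

(** Removing a suitable vertex [y] from a component of [A] leaves a connected set [K], in which [y]
    has at most one neighbor by [forest_connected_neighbor]. *)
Lemma forest_leaf A : A != set0 ->
  exists2 x, x \in A &
    forall y z, y \in A -> z \in A -> adj x y -> adj x z -> y = z.
Proof.
move=> /set0Pn[x Ax]; pose D := [set y | connect (adj_in A) x y].
have DA y : y \in D -> y \in A.
  by rewrite inE => /connect_adj_in_mem; apply.
have adjD u v : u \in D -> v \in A -> adj u v -> v \in D.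
  move=> Du Av uv; have Au := DA u Du; move: Du; rewrite !inE => /connect_trans; apply.
  by apply/connect1/and3P.
have Dx : x \in D by rewrite inE.
have [D1 | D1] := eqVneq D [set x].
  exists x => // y z Ay Az xy _; have := adjD _ _ Dx Ay xy.
  by rewrite D1 => /set1P yx; rewrite yx adj_irrefl in xy.
have [K [y [cK nKy DE]]] := connected_set_remove (connected_set_component Ax) Dx D1.
have Dy : y \in D by rewrite /D DE setU11.
have KD z : z \in A -> adj y z -> z \in K.
  move=> Az yz; have := adjD _ _ Dy Az yz; rewrite /D DE => /setU1P[zy|//].
  by rewrite zy adj_irrefl in yz.
exists y => [|a b Aa Ab ya yb]; first exact: DA.
by apply: (forest_connected_neighbor cK nKy) => //; apply: KD.
Qed.

(* Built by peeling off leaves. *)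
Lemma forest_parent :
  exists (par : T -> option T) (rk : T -> nat),
    (forall x y, par x = Some y -> adj x y /\ rk y < rk x) /\
    (forall x y, adj x y -> par x = Some y \/ par y = Some x).
Proof.
suff /(_ setT)[par [rk [parP adjP _]]] : forall A,
    exists (par : T -> option T) (rk : T -> nat),
    [/\ forall x y, par x = Some y -> [/\ x \in A, y \in A, adj x y & rk y < rk x],
        {in A &, forall x y, adj x y -> par x = Some y \/ par y = Some x} &
        forall x, rk x <= #|A|].
  by exists par, rk; split=> [x y /parP[] // | x y]; apply: adjP; rewrite inE.
move=> A; elim: {A}_.+1 {-2}A (ltnSn #|A|) => // n IHn A leAn.
have [A0 | A0] := eqVneq A set0.
  by exists (fun=> None), (fun=> 0); split=> // x y; rewrite A0 inE.
have [v Av leafv] := forest_leaf A0; have cardA := cardsD1 v A.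
rewrite Av add1n in cardA; rewrite cardA ltnS in leAn.
have [par [rk [parP adjP rkP]]] := IHn (A :\ v) leAn.
(* The leaf [v] gets its only neighbor in [A], if any, as parent, and the rank [#|A|], above all
   earlier ranks, which are at most [#|A :\ v|]. *)
exists (fun x => if x == v then [pick u | (u \in A) && adj v u] else par x).
exists (fun x => if x == v then #|A| else rk x).
split=> [x y | x y Ax Ay xy | x]; last by rewrite cardA; case: eqP => // _; apply: leqW.
  have [-> | xv] := eqVneq x v.
    case: pickP => // z /andP[Az vz] [<-]; split=> //.
    case: eqVneq => [zv | _]; first by rewrite zv adj_irrefl in vz.
    by rewrite cardA ltnS.
  move=> /parP[]; rewrite !inE => /andP[_ Ax] /andP[yv Ay] xy lt.
  by rewrite (negPf yv).
have pickv z : z \in A -> adj v z -> [pick u | (u \in A) && adj v u] = Some z.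
  move=> Az vz; case: pickP => [u /andP[Au vu] | /(_ z)]; last by rewrite Az vz.
  by rewrite (leafv u z).
case: (eqVneq x v) (eqVneq y v) => [xv|xv] [yv|yv].
- by rewrite xv yv adj_irrefl in xy.
- by left; apply: pickv; rewrite // -xv.
- by right; apply: pickv; rewrite // -yv adj_sym.
- by apply: adjP => //; rewrite !inE ?xv ?yv.
Qed.

(** Build [K] up from one vertex. Absorbing a boundary vertex [v] costs [v] itself but gains at
    least [s] other neighbors of [v], which are new because [T] is a forest; as [s > 0], the
    boundary never shrinks. *)
Lemma connected_boundary s K : 0 < s -> connected_set K ->
  {in K, forall x, s < degree x} ->
  s < #|[set y | (y \notin K) && [exists x in K, adj x y]]|.
Proof.
move=> s_gt0 cK degK.
pose bd (B : {set T}) := [set y | (y \notin B) && [exists x in B, adj x y]].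
rewrite -/(bd K); have /connected_setP[/set0Pn[x Kx] _] := cK.
have: exists2 B : {set T}, connected_set B & [/\ x \in B, B \subset K & s < #|bd B|].
  exists [set x]; first exact: connected_set1.
  rewrite set11 sub1set Kx; split=> //.
  apply: leq_trans (degK x Kx) _; apply/subset_leq_card/subsetP => y.
  rewrite !inE => xy; apply/andP; split; last by apply/exists_inP; exists x; rewrite ?set11.
  by apply: contraL xy => /eqP->; rewrite adj_irrefl.
case=> B; elim: {B}_.+1 {-2}B (ltnSn #|K :\: B|) => // n IHn B leBn cB [Bx sBK bdB].
have [<- // | BK] := eqVneq B K.
have [u [v [Bu /setDP[Kv nBv] uv]]] := connected_set_exit cK sBK Bx BK.
have cvB := connected_setU1 cB Bu uv.
apply: (IHn _ _ cvB).
  apply: leq_trans (_ : #|K :\: B| <= n) => //; apply: proper_card.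
  rewrite properE setDS ?subsetUr //=; apply/subsetPn; exists v; first by rewrite inE nBv.
  by rewrite !inE eqxx.
split; [by rewrite inE Bx orbT | by rewrite subUset sub1set Kv |].
pose N := [set y | adj v y] :\ u.
have Nbd : N \subset bd (v |: B).
  apply/subsetP => y; rewrite !inE negb_or => /andP[yu vy].
  have yv : y != v by apply: contraTneq vy => ->; rewrite adj_irrefl.
  rewrite yv /=; apply/andP; split; last by apply/exists_inP; exists v; rewrite ?setU11.
  apply: contra yu => By; apply/eqP.
  by apply: (forest_connected_neighbor cB nBv) => //; rewrite adj_sym.
have Bbd : bd B :\ v \subset bd (v |: B).
  apply/subsetP => y; rewrite !inE negb_or => /and3P[-> -> /exists_inP[z Bz zy]] /=.
  by apply/exists_inP; exists z; rewrite // inE Bz orbT.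
(* A common element would have two neighbors, [v] and some [z] in [B], in the connected set
   [v |: B]. *)
have disj : [disjoint N & bd B :\ v].
  apply/pred0P => y; apply/negP => /=; rewrite !inE => /andP[/andP[yu vy]].
  move=> /and3P[yv nBy /exists_inP[z Bz zy]].
  suff zv : z = v by rewrite -zv Bz in nBv.
  apply: (forest_connected_neighbor cvB (y := y)); rewrite ?inE ?eqxx ?Bz ?orbT //.
  - by rewrite negb_or yv.
  - by rewrite adj_sym.
  - by rewrite adj_sym.
have : #|N :|: (bd B :\ v)| <= #|bd (v |: B)|.
  by apply/subset_leq_card; rewrite subUset Nbd.
apply: leq_trans; rewrite cardsU (disjoint_setI0 disj) cards0 subn0.
have := degK v Kv; rewrite /degree (cardsD1 u) inE adj_sym uv -/N ltnS => sN.
have := cardsD1 v (bd B); rewrite inE nBv /=.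
have -> : [exists x in B, adj x v] by apply/exists_inP; exists u.
move=> bdE; rewrite bdE ltnS in bdB.
apply: leq_trans (leq_add (leq_trans s_gt0 sN) bdB).
by rewrite add1n.
Qed.

End Forests.

Lemma stableP (G : sgraph) (A : {set G}) :
  reflect {in A &, forall x y, ~~ adj x y} (stable A).
Proof.
apply: (iffP forall_inP) => [sA x y Ax | sA x Ax]; first exact: (forall_inP (sA x Ax)).
by apply/forall_inP => y; apply: sA.
Qed.

(* Koenig duality: a maximum stable set and an equally large cover by edges and
   single vertices. *)
Lemma forest_stable_cover (T : sgraph) (T_forest : is_forest T) (A : {set T}) :
  exists (S : {set T}) (l : seq (T * T)),
    [/\ S \subset A, stable S, size l = #|S|,
        {in l, forall p, (p.1 == p.2) || adj p.1 p.2} &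
        {in A, forall x, exists2 p, p \in l & x \in pred2 p.1 p.2}].
Proof.
elim: {A}_.+1 {-2}A (ltnSn #|A|) => // n IHn A leAn.
have [A0 | A0] := eqVneq A set0.
  exists set0, [::]; rewrite sub0set cards0; split=> // [|x]; last by rewrite A0 inE.
  by apply/stableP => x y; rewrite inE.
have [v Av leafv] := forest_leaf T_forest A0.
(* [u] is the only neighbor of the leaf [v] in [A], or [v] itself if there is none. After discarding
   both, [S] gains [v] and [l] gains [(v, u)]. *)
have [u [uP Nu]] : exists u, ((v == u) || adj v u) /\
    {in A, forall y, adj v y -> y = u}.
  case: (pickP [pred u in A | adj v u]) => [u /andP[Au vu] | nov].
    by exists u; rewrite vu orbT; split=> // y Ay vy; apply: leafv.
  by exists v; rewrite eqxx; split=> // y Ay vy; have := nov y; rewrite /= Ay vy.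
have ltA : #|A :\ v :\ u| < n.
  rewrite ltnS (cardsD1 v) Av in leAn; apply: leq_trans leAn.
  by rewrite add1n ltnS; apply/subset_leq_card/subD1set.
have [S [l [sSA stS szl lP cov]]] := IHn _ ltA.
have SA x : x \in S -> [/\ x != u, x != v & x \in A].
  by move=> /(subsetP sSA); rewrite !inE => /and3P[].
have nvS : v \notin S by apply/negP => /SA[_]; rewrite eqxx.
exists (v |: S), ((v, u) :: l); split.
- by rewrite subUset sub1set Av; apply/subsetP => x /SA[].
- have nSv x : x \in S -> ~~ adj v x.
    by move=> /SA[xu _ Ax]; apply/negP => /(Nu x Ax) xu'; rewrite xu' eqxx in xu.
  apply/stableP => x y /setU1P[->|Sx] /setU1P[->|Sy].
  + by rewrite adj_irrefl.
  + exact: nSv.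
  + by rewrite adj_sym nSv.
  + exact: (stableP _ stS).
- by rewrite /= szl cardsU1 nvS.
- by move=> p; rewrite inE => /predU1P[->|/lP].
move=> x Ax; have [xv|xv] := eqVneq x v.
  by exists (v, u); rewrite ?inE ?eqxx //= xv eqxx.
have [xu|xu] := eqVneq x u.
  by exists (v, u); rewrite ?inE ?eqxx //= xu eqxx orbT.
have [|p lp xp] := cov x; first by rewrite !inE xu xv.
by exists p; rewrite // inE lp orbT.
Qed.

Definition low_vertices (s : nat) (T : sgraph) : {set T} := [set x | degree x <= s].

Lemma alpha_low_ge (s : nat) (T : sgraph) (S : {set T}) :
  S \subset low_vertices s T -> stable S -> #|S| <= alpha_low s T.
Proof.
move=> /subsetP lowS /stableP stS.
pose A : {set induced (low_vertices s T)} := [set x | val x \in S].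
have -> : #|S| = #|A|.
  rewrite -(card_imset A val_inj); apply: eq_card => x.
  apply/idP/imsetP => [Sx | [y]]; last by rewrite inE => ? ->.
  by exists (exist _ x (lowS x Sx)); rewrite ?inE.
apply: (leq_bigmax_cond (F := fun A : {set induced _} => #|A|)).
by apply/stableP => x y; rewrite !inE; apply: stS.
Qed.

Lemma alpha_low_witness (s : nat) (T : sgraph) :
  exists S : {set T}, [/\ S \subset low_vertices s T, stable S & #|S| = alpha_low s T].
Proof.
have st0 : stable (set0 : {set induced (low_vertices s T)}).
  by apply/stableP => x y; rewrite inE.
have [|A stA AE] := @eq_bigmax_cond _ [pred A | @stable (induced (low_vertices s T)) A]
  (fun A : {set induced _} => #|A|).
  by apply/card_gt0P; exists set0.
exists [set val x | x in A]; split.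
- by apply/subsetP => _ /imsetP[x _ ->]; apply: valP.
- apply/stableP => _ _ /imsetP[x Ax ->] /imsetP[y Ay ->].
  exact: (stableP _ stA x y).
- rewrite card_imset; last exact: val_inj.
  by rewrite -AE; apply: eq_bigl.
Qed.

(** * Copies and embeddings *)

Lemma edge_set2 (G : sgraph) (x y : G) : ([set x; y] \in edges G) = adj x y.
Proof.
apply/imsetP/idP => [[[a b]] | xy]; last by exists (x, y); rewrite ?inE.
rewrite inE /= => ab eq_xy.
have [ax bx] : (a \in [set x; y]) /\ (b \in [set x; y]) by rewrite eq_xy !inE !eqxx orbT.
move: ax bx ab => /set2P[->|->] /set2P[->|->]; rewrite ?adj_irrefl //.
by rewrite adj_sym.
Qed.

Section Embeddings.
Variables H G : sgraph.
Implicit Type f : {ffun H -> G}.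

Definition embeddings : {set {ffun H -> G}} :=
  [set f : {ffun H -> G} | injectiveb f && [forall x, forall y, adj x y ==> adj (f x) (f y)]].

Lemma embeddingsP f :
  reflect (injective f /\ {homo f : x y / adj x y}) (f \in embeddings).
Proof.
rewrite inE; apply: (iffP andP) => [[/injectiveP fI /forallP fh] | [fI fh]].
  by split=> // x y xy; have /forallP/(_ y)/implyP := fh x; apply.
split; first exact/injectiveP.
by apply/forallP => x; apply/forallP => y; apply/implyP/fh.
Qed.

Definition image_subgraph f : {set G} * {set {set G}} :=
  (f @: [set: H], [set f @: e | e : {set H} in edges H]).

(** The inverse of an isomorphism from a copy to [H] is an embedding with that copy as its
    [image_subgraph]. *)
Lemma copies_le_embeddings : copies H G <= #|embeddings|.
Proof.
apply: leq_trans (leq_imset_card image_subgraph (mem embeddings)).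
apply/subset_leq_card/subsetP => -[V E].
rewrite inE => /andP[/andP[/subsetP EG /forall_inP EV]].
move=> /asboolP[h [g hK gK] hadj]; rewrite /= in EG EV *.
pose f := [ffun x => val (g x)].
have fE x y : adj x y = ([set f x; f y] \in E).
  rewrite -{1}[x]gK -{1}[y]gK hadj !ffunE /= /subgraph_adj andbC.
  apply: andb_idr => /EG; rewrite edge_set2; apply: contraTneq => ->.
  by rewrite adj_irrefl.
apply/imsetP; exists f; last congr pair.
- apply/embeddingsP; split=> [x y | x y]; first by rewrite !ffunE => /val_inj/(can_inj gK).
  by rewrite fE => /EG; rewrite edge_set2.
- apply/setP => v; apply/idP/imsetP => [Vv | [x _ ->]]; last by rewrite ffunE; apply: valP.
  by exists (h (exist _ v Vv)); rewrite // ffunE hK.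
apply/setP => e; apply/idP/imsetP => [Ee | [_ /imsetP[[x y] xy ->] ->]]; last first.
  by rewrite inE in xy; rewrite imsetU1 imset_set1 -fE.
have /imsetP[[a b] _ /= eE] := EG e Ee; rewrite eE in Ee *.
have := EV _ Ee; rewrite subUset !sub1set => /andP[Va Vb].
exists [set h (exist _ a Va); h (exist _ b Vb)]; last first.
  by rewrite imsetU1 imset_set1 !ffunE !hK.
by rewrite edge_set2 fE !ffunE !hK.
Qed.

Lemma image_subgraph_copy f :
  injective f -> (forall x y, adj (f x) (f y) = adj x y) ->
  is_subgraph (image_subgraph f) /\ isomorphic (subgraph_graph (image_subgraph f)) H.
Proof.
move=> fI fadj; have fE x y : ([set f x; f y] \in (image_subgraph f).2) = adj x y.
  apply/imsetP/idP => [[_ /imsetP[[a b] ab ->]] | xy].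
    rewrite inE in ab; rewrite imsetU1 imset_set1 => eq_f.
    by rewrite -fadj -edge_set2 eq_f edge_set2 fadj.
  by exists [set x; y]; rewrite ?edge_set2 // imsetU1 imset_set1.
split.
  apply/andP; split.
    apply/subsetP => _ /imsetP[_ /imsetP[[x y] xy ->] ->].
    by rewrite inE in xy; rewrite imsetU1 imset_set1 edge_set2 fadj.
  by apply/forall_inP => _ /imsetP[e _ ->]; apply/imsetS/subsetT.
have fV x : f x \in (image_subgraph f).1 by apply: imset_f.
pose g x : subgraph_graph (image_subgraph f) := exist _ (f x) (fV x).
have gI : injective g by move=> x y [/fI].
have [|h gK hK] := inj_card_bij gI.
  by rewrite card_sig -[leqRHS]cardsT; apply: leq_imset_card.
exists h; first by exists g.
move=> x y; rewrite -{2}[x]hK -{2}[y]hK [RHS]/= /subgraph_adj /= fE.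
by rewrite andb_idl // => xy; apply: contraTneq xy => /fI ->; rewrite adj_irrefl.
Qed.

End Embeddings.

(** * Sunflowers of functions *)

(** Greedy choice: each chosen [x] rules out at most [M] elements. *)
Lemma independent_seq (X : finType) (r : rel X) (M t : nat) (F : {set X}) :
  {in F, forall x, r x x} -> {in F, forall x, #|[set y in F | r x y]| <= M} ->
  t * M < #|F| ->
  exists l : seq X, [/\ size l = t, {subset l <= F} & pairwise (fun x y => ~~ r x y) l].
Proof.
elim: t F => [|t IHt] F rF leM ltF; first by exists [::].
have /card_gt0P[x Fx] : 0 < #|F| by apply: leq_ltn_trans ltF.
have sub : F :\: [set y in F | r x y] \subset F by apply: subsetDl.
have [|y Fy||l [szl lF pl]] := IHt (F :\: [set y in F | r x y]).
- by move=> y /(subsetP sub)/rF.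
- have /leM leMy := subsetP sub y Fy.
  apply: leq_trans leMy; apply/subset_leq_card/subsetP => z; rewrite !inE.
  by move=> /andP[/andP[_ ->] ->].
- have sxF : [set y in F | r x y] \subset F by apply/subsetP => z; rewrite inE => /andP[].
  have := leM x Fx; rewrite cardsD (setIidPr sxF); move: ltF; rewrite mulSn.
  lia.
exists (x :: l); split=> [|y|]; first by rewrite /= szl.
  by rewrite inE => /predU1P[-> // | /lF/(subsetP sub)].
rewrite /= pl andbT; apply/allP => y /lF; rewrite !inE negb_and.
by case/andP => /orP[/negPf-> //|].
Qed.

Lemma leq_card_bigcup (I X : finType) (B : I -> {set X}) :
  #|\bigcup_i B i| <= \sum_i #|B i|.
Proof.
apply: (big_ind2 (fun (A : {set X}) n => #|A| <= n)) => [|A m A' m' leA leA'|//].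
  by rewrite cards0.
exact: leq_trans (leq_card_setU A A').1 (leq_add leA leA').
Qed.

(** Induction on the number of points outside [J0]. If many functions share a value at such a point,
    add the point to [J0]. Otherwise the image of each function outside [J0] meets only few others,
    and [independent_seq] picks [t] disjoint ones. *)
Lemma function_sunflower (X : finType) (t k : nat) :
  exists N, forall (Y : finType) (J0 : {set X}) (F : {set {ffun X -> Y}}),
    #|~: J0| = k -> {in F &, forall f g : {ffun X -> Y}, {in J0, f =1 g}} -> N <= #|F| ->
  exists (J : {set X}) (l : seq {ffun X -> Y}),
    [/\ J0 \subset J /\ J != setT, size l = t, {subset l <= F},
        {in l &, forall f g : {ffun X -> Y}, {in J, f =1 g}} &
        pairwise (fun f g : {ffun X -> Y} => [disjoint f @: ~: J & g @: ~: J]) l].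
Proof.
elim: k => [|k [N IHN]].
  (* With no point outside [J0], all functions in [F] agree, so [F] cannot have two elements. *)
  exists 2 => Y J0 F /cards0_eq J0T eqF /card_gt1P[f [g [Ff Fg]]] /eqP[].
  by apply/ffunP => x; apply: eqF; rewrite // -[J0]setCK J0T setC0 inE.
(* For fixed [f], the images of [f] and [g] meet only if [g z = f y] for one of the [#|X| * #|X|]
   pairs [(z, y)]; in the second case each pair admits fewer than [N] functions [g]. *)
exists (t * (#|X| * (#|X| * N))).+1 => Y J0 F cJ0 eqF ltF.
case: (boolP [exists x in ~: J0, exists v, N <= #|[set f in F | f x == v]|]).
  move=> /exists_inP[x Jx /existsP[v leN]].
  have [|f g|J [l [[sJ JT] szl lF eql pl]]] := IHN Y (x |: J0) _ _ _ leN.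
  - apply: succn_inj; rewrite -cJ0 (cardsD1 x (~: J0)) Jx add1n; congr _.+1.
    by apply: eq_card => y; rewrite !inE negb_or.
  - rewrite !inE => /andP[Ff /eqP fx] /andP[Fg /eqP gx] y /setU1P[->|Jy].
      by rewrite fx gx.
    exact: eqF.
  exists J, l; split=> // [|f /lF]; last by rewrite inE => /andP[].
  by split=> //; apply: subset_trans sJ; apply: subsetUr.
move=> few; have [x Jx] : exists x, x \in ~: J0 by apply/set0Pn; rewrite -card_gt0 cJ0.
pose r (f g : {ffun X -> Y}) := ~~ [disjoint f @: ~: J0 & g @: ~: J0].
have [f Ff|f Ff|l [szl lF pl]] := @independent_seq _ r _ t F _ _ ltF.
- apply/negP => /pred0P/(_ (f x)).
  by rewrite /= imset_f.
- pose B (p : X * X) := [set g in F | (p.1 \in ~: J0) && (g p.1 == f p.2)].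
  have sub : [set g in F | r f g] \subset \bigcup_p B p.
    apply/subsetP => g; rewrite inE => /andP[Fg /pred0Pn[v /= /andP[]]].
    move=> /imsetP[y _ ->] /imsetP[z Jz fz]; apply/bigcupP; exists (z, y) => //.
    by rewrite !inE Fg /= -in_setC Jz fz eqxx.
  apply: leq_trans (subset_leq_card sub) _.
  apply: leq_trans (leq_card_bigcup _) _.
  rewrite mulnA -card_prod -sum_nat_const; apply: leq_sum => -[z y] _.
  rewrite /B /=; case: (boolP (z \in ~: J0)) => Jz; last first.
    rewrite (_ : [set _ in _ | _] = set0) ?cards0 //.
    by apply/setP => g; rewrite !inE andbF.
  move: few; rewrite negb_exists_in => /forall_inP/(_ z Jz); rewrite negb_exists.
  by move=> /forallP/(_ (f y)); rewrite -ltnNge => /ltnW.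
exists J0, l; split=> //.
- by split=> //; rewrite -subTset; apply/subsetPn; exists x => //; rewrite -in_setC.
- by move=> f g /lF Ff /lF Fg; apply: eqF.
by apply: sub_pairwise pl => f g; rewrite /r negbK.
Qed.

(** * The upper bound *)

(** Ordered pairs, so that each edge counts twice and the number of arcs is the degree sum. *)
Definition arcs (G : sgraph) : {set G * G} := [set p | adj p.1 p.2].

Lemma is_minorP (H G : sgraph) :
  is_minor H G <->
  exists B : H -> {set G},
    [/\ forall x, connected_set (B x),
        forall x y, x != y -> [disjoint B x & B y] &
        forall x y, adj x y -> exists u v, [/\ u \in B x, v \in B y & adj u v]].
Proof.
by split=> -[B [cB dB aB]]; exists B; split=> // x; apply/is_connected_induced.
Qed.

(* The branch sets are the common images of [s.+1] boundary vertices of a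
   component [K] outside [J], and the images of [K] under the petals. *)
Lemma sunflower_minor (T G : sgraph) (T_forest : is_forest T) (s t : nat)
    (J : {set T}) (l : seq {ffun T -> G}) :
  0 < s -> 0 < t -> low_vertices s T \subset J -> J != setT -> size l = t ->
  {subset l <= embeddings T G} ->
  {in l &, forall f g : {ffun T -> G}, {in J, f =1 g}} ->
  pairwise (fun f g : {ffun T -> G} => [disjoint f @: ~: J & g @: ~: J]) l ->
  is_minor (complete_bipartite s.+1 t) G.
Proof.
move=> s_gt0 t_gt0 lowJ JT szl lE eql pl.
have [x nJx] : exists x, x \in ~: J.
  by apply/set0Pn; apply: contraNneq JT => /(congr1 (@setC _)); rewrite setCK setC0 => ->.
pose K := [set y | connect (adj_in (~: J)) x y].
have KJ y : y \in K -> y \notin J.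
  by rewrite -in_setC inE => /connect_adj_in_mem; apply.
have cK : connected_set K by apply: connected_set_component.
pose bd := [set y | (y \notin K) && [exists x in K, adj x y]].
have ltbd : s < #|bd|.
  apply: connected_boundary => // y /KJ; apply: contraR; rewrite -leqNgt => low_y.
  by apply: (subsetP lowJ); rewrite inE.
(* A neighbor of the component [K] outside [J] would itself lie in [K]. *)
have bdJ y : y \in bd -> y \in J.
  rewrite inE => /andP[nKy /exists_inP[z Kz zy]]; apply: contraR nKy => nJy.
  move: (Kz); rewrite !inE => /connect_trans; apply; apply/connect1/and3P.
  by rewrite !inE nJy KJ.
pose w (j : 'I_s.+1) : T := enum_val (widen_ord ltbd j).
have w_bd j : w j \in bd by apply: enum_valP.
have wI : injective w by move=> i j /enum_val_inj/(congr1 val)/= ij; apply: val_inj.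
(* As [t > 0], there is a petal [f0]; all petals share its values on [J]. *)
have [f0 lf0] : exists f0, f0 \in l.
  case: l szl {lE eql pl} => [t0|f0 l _]; last by exists f0; rewrite mem_head.
  by rewrite -t0 in t_gt0.
pose f (i : 'I_t) := nth f0 l i.
have lf i : f i \in l by apply: mem_nth; rewrite szl.
have /all_and2[fI fh] i := embeddingsP _ (lE _ (lf i)).
have f0I := (embeddingsP _ (lE _ lf0)).1.
have f0w i j : f0 (w j) = f i (w j) by apply: eql => //; apply: bdJ.
have sKJ : K \subset ~: J by apply/subsetP => y /KJ; rewrite inE.
have disj (i j : 'I_t) : i < j -> [disjoint f i @: K & f j @: K].
  move=> ij; have /(pairwiseP f0)/(_ i j) := pl.
  rewrite !inE szl !ltn_ord => /(_ isT isT ij).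
  by apply: disjointW; apply: imsetS.
have disjw i j : [disjoint [set f0 (w j)] & f i @: K].
  rewrite disjoints1; apply/imsetP => -[y Ky]; rewrite (f0w i) => /fI wy.
  by have := KJ y Ky; rewrite -wy bdJ.
have adjw i j : exists2 u, u \in f i @: K & adj u (f0 (w j)).
  have := w_bd j; rewrite inE => /andP[_ /exists_inP[y Ky yw]].
  by exists (f i y); rewrite ?imset_f // (f0w i); apply: fh.
apply/is_minorP; exists (fun v : complete_bipartite s.+1 t =>
  match v with inl j => [set f0 (w j)] | inr i => f i @: K end); split.
- by case=> [j|i]; [apply: connected_set1 | apply: connected_set_imset].
- move=> [j|i] [j'|i'] neq.
  + by rewrite disjoints1 inE; apply: contraNneq neq => /f0I/wI ->.
  + exact: disjw.
  + by rewrite disjoint_sym; apply: disjw.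
  + have : i != i' by apply: contraNneq neq => ->.
    by rewrite neq_ltn => /orP[] lt; last rewrite disjoint_sym; apply: disj.
move=> [j|i] [j'|i'] //= _.
  have [u Ku uw] := adjw i' j; exists (f0 (w j)), u; rewrite set11 adj_sym; by [].
by have [u Ku uw] := adjw i j'; exists u, (f0 (w j')); rewrite set11.
Qed.

Lemma card_le_fibers (X Y : finType) (A : {set X}) (B : {pred Y}) (c : X -> Y) N :
  {in A, forall x, c x \in B} ->
  (forall y, #|[set x in A | c x == y]| <= N) -> #|A| <= #|B| * N.
Proof.
move=> cA leN; rewrite -sum1_card (partition_big c (mem B)) //= -sum_nat_const.
apply: leq_sum => y _; apply: leq_trans (leN y).
by rewrite -sum1_card; apply/eq_leq/eq_bigl => x; rewrite inE.
Qed.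

(** An embedding is coded by the images of the pairs in the cover [l], each an arc or a diagonal
    pair of [G]. The code determines the embedding on the low vertices, so a fiber with more than
    [N] elements would contain a sunflower and yield the excluded minor. *)
Lemma card_embeddings_le (T : sgraph) (T_forest : is_forest T) (s t : nat) :
  0 < s -> 0 < t -> exists N, forall G : sgraph, 0 < #|G| ->
  ~ is_minor (complete_bipartite s.+1 t) G ->
  #|embeddings T G| <= (#|G| + #|arcs G|) ^ alpha_low s T * N.
Proof.
move=> s_gt0 t_gt0; have [N sunflower] := function_sunflower T t #|~: low_vertices s T|.
exists N => G G_gt0 no_minor.
have [S [l [sS stS szl lP cov]]] := forest_stable_cover T_forest (low_vertices s T).
pose P := [set (x, x) | x : G] :|: arcs G.
have leP : #|P| <= #|G| + #|arcs G|.
  by apply: leq_trans (leq_card_setU _ _).1 _; rewrite leq_add2r leq_imset_card.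
pose code (f : {ffun T -> G}) :=
  [ffun i => (f (tnth (in_tuple l) i).1, f (tnth (in_tuple l) i).2)].
have codeP f : f \in embeddings T G -> code f \in ffun_on (mem P).
  move=> /embeddingsP[_ fh]; apply/ffun_onP => i; rewrite ffunE !inE /=.
  have /orP[/eqP<-|/fh->] := lP _ (mem_tnth i (in_tuple l)); last by rewrite orbT.
  by rewrite imset_f.
have fibN y : #|[set f in embeddings T G | code f == y]| <= N.
  rewrite leqNgt; apply/negP => /ltnW leN; apply: no_minor.
  have [f g|J [l' [[sJ JT] szl' lF eql pl]]] := sunflower _ _ _ erefl _ leN.
  - rewrite !inE => /andP[_ /eqP<-] /andP[_ /eqP/ffunP fg] x /cov[p lp xp].
    have [i pE] := tnthP (in_tuple l) p lp.
    have := fg i; rewrite !ffunE -pE => -[fg1 fg2].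
    by case/orP: xp => /eqP->.
  apply: (sunflower_minor T_forest s_gt0 t_gt0 sJ JT szl' _ eql pl).
  by move=> f /lF; rewrite inE => /andP[].
apply: leq_trans (card_le_fibers codeP fibN) _.
rewrite leq_mul2r card_ffun_on card_ord szl; apply/orP; right.
have X_gt0 : 0 < #|G| + #|arcs G| by rewrite addn_gt0 G_gt0.
apply: leq_trans (leq_pexp2l X_gt0 (alpha_low_ge sS stS)).
by have [->|S_gt0] := posnP #|S|; rewrite ?expn0 // leq_exp2r.
Qed.

(** * Dense graphs have large clique minors *)

(** Branch sets compose by unions; a path inside a branch set in [K] lifts step by step to a
    connection inside the union. *)
Lemma is_minor_trans (H K G : sgraph) : is_minor H K -> is_minor K G -> is_minor H G.
Proof.
move=> /is_minorP[B [cB dB aB]] /is_minorP[B' [cB' dB' aB']].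
apply/is_minorP; exists (fun h => \bigcup_(v in B h) B' v); split.
- move=> h; set D := \bigcup_(v in _) _.
  have /connected_setP[/set0Pn[v0 Bv0] cBh] := cB h.
  have /connected_setP[/set0Pn[u0 Bu0] _] := cB' v0.
  have sub v : v \in B h -> subrel (adj_in (B' v)) (adj_in D).
    by move=> Bv; apply/adj_inS/bigcup_sup.
  exists u0; first by apply/bigcupP; exists v0.
  move=> b /bigcupP[v Bv Bb].
  have /connectP[p pp vE] := cBh v0 v Bv0 Bv.
  elim: p v0 Bv0 u0 Bu0 pp vE => [|v1 p IHp] v0 Bv0 u0 Bu0 /=.
    move=> _ vE; have /connected_setP[_ cB'v] := cB' v.
    by apply: sub_connect (sub v Bv) (cB'v _ _ _ Bb); rewrite vE.
  move=> /andP[/and3P[_ Bv1 v01] pp vE].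
  have [a [a' [Ba Ba' aa']]] := aB' _ _ v01.
  have /connected_setP[_ cB'v] := cB' v0.
  apply: connect_trans (sub_connect (sub v0 Bv0) (cB'v _ _ Bu0 Ba)) _.
  apply: connect_trans (IHp v1 Bv1 a' Ba' pp vE); apply/connect1/and3P.
  by split=> //; apply/bigcupP; [exists v0 | exists v1].
- move=> x y xy; apply/pred0P => u; apply/negP.
  move=> /andP[/bigcupP[v Bv uv] /bigcupP[v' Bv' uv']].
  have [vv'|vv'] := eqVneq v v'.
    by have /pred0P/(_ v) := dB _ _ xy; rewrite /= Bv vv' Bv'.
  by have /pred0P/(_ u) := dB' _ _ vv'; rewrite /= uv uv'.
- move=> x y /aB[v [v' [Bv Bv' /aB'[u [u' [Bu Bu' uu']]]]]].
  by exists u, u'; split=> //; apply/bigcupP; [exists v | exists v'].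
Qed.

Section Quotient.
Variables (G : sgraph) (V : finType) (c : G -> V).

Definition quotient_adj : rel V :=
  fun u v => (u != v) && [exists a, exists b, [&& c a == u, c b == v & adj a b]].

Lemma quotient_sym : symmetric quotient_adj.
Proof.
move=> u v; rewrite /quotient_adj eq_sym; congr (_ && _).
by apply/existsP/existsP => -[a /existsP[b /and3P[ab cu cv]]];
   exists b; apply/existsP; exists a; apply/and3P; rewrite adj_sym.
Qed.

Lemma quotient_irrefl : irreflexive quotient_adj.
Proof. by move=> u; rewrite /quotient_adj eqxx. Qed.

Definition quotient : sgraph := SGraph quotient_sym quotient_irrefl.

Lemma quotient_minor : (forall v, connected_set (c @^-1: [set v])) -> is_minor quotient G.
Proof.
move=> cV; apply/is_minorP; exists (fun v => c @^-1: [set v]); split=> // u v.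
  move=> uv; apply/pred0P => a; apply/negP; rewrite /= !inE => /andP[/eqP-> uv'].
  by rewrite uv' in uv.
by move=> /andP[_ /existsP[a /existsP[b /and3P[au bv ab]]]]; exists a, b; rewrite !inE.
Qed.

End Quotient.

Lemma card_arcs (G : sgraph) : #|arcs G| = \sum_(x : G) degree x.
Proof.
rewrite -sum1_card (eq_bigl (fun p : G * G => adj p.1 p.2)) => [|p]; last by rewrite inE.
rewrite -(pair_big_dep xpredT (@adj G) (fun _ _ => 1)) /=.
by apply: eq_bigr => x _; rewrite sum1dep_card.
Qed.

Definition common_neighbors (G : sgraph) (x y : G) : {set G} :=
  [set z | adj x z && adj y z].

(** Merging [y] into [x] loses the two arcs between them and two more for each common neighbor,
    whose arcs with [x] and with [y] become equal. *)
Lemma contract_edge (G : sgraph) (x y : G) : adj x y ->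
  exists K : sgraph, [/\ is_minor K G, 0 < #|K|, #|G| = #|K|.+1 &
    #|arcs G| <= #|arcs K| + 2 * #|common_neighbors x y|.+1].
Proof.
move=> xy; have x_neq_y : x != y by apply: contraTneq xy => ->; rewrite adj_irrefl.
pose V : finType := {z : G | z != y}; pose x' : V := exist _ x x_neq_y.
(* The default value of [insubd] sends [y], the only vertex outside [V], to [x]. *)
pose c (z : G) : V := insubd x' z.
have cE z : z != y -> val (c z) = z by move=> zy; apply: insubdK.
have cy : c y = x' by apply: val_inj; rewrite val_insubd eqxx.
have cV : #|G| = #|V|.+1.
  by rewrite card_sig -(cardC (pred1 y)) card1 add1n.
exists (quotient c); split=> //.
- apply: quotient_minor => v; exists (val v).
    by rewrite !inE; apply/eqP/val_inj/cE/(valP v).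
  move=> z; rewrite !inE => /eqP zv; have [zy|zy] := eqVneq z y.
    apply/connect1; rewrite -zv zy cy /adj_in !inE /= cy xy eqxx !andbT.
    by apply/eqP/val_inj/cE.
  by rewrite -zv cE.
- by apply/card_gt0P; exists x'.
(* [bad] consists of the arcs joining [y] to [x] or to a common neighbor; on the other arcs the
   contraction is injective and creates no loop. *)
pose Z := x |: common_neighbors x y.
pose bad := [set (y, z) | z in Z] :|: [set (z, y) | z in Z].
have leZ : #|Z| <= #|common_neighbors x y|.+1.
  by rewrite cardsU1 -add1n leq_add2r; case: (_ \notin _).
have le_bad : #|bad| <= 2 * #|common_neighbors x y|.+1.
  apply: leq_trans (leq_card_setU _ _).1 _; rewrite mul2n -addnn.
  by apply: leq_add; apply: leq_trans (leq_imset_card _ _) leZ.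
pose c2 (p : G * G) := (c p.1, c p.2).
have ceq u v : c u = c v -> [\/ u = v, u = x /\ v = y | u = y /\ v = x].
  move=> cuv; have [uy|uy] := eqVneq u y; have [vy|vy] := eqVneq v y.
  - by constructor 1; rewrite uy vy.
  - by constructor 3; split=> //; rewrite -(cE v vy) -cuv uy cy.
  - by constructor 2; split=> //; rewrite -(cE u uy) cuv vy cy.
  - by constructor 1; rewrite -(cE v vy) -cuv cE.
have Zx : x \in Z by rewrite setU11.
have badr z : z \in Z -> (z, y) \in bad.
  by move=> Zz; rewrite inE [X in _ || X]imset_f ?orbT.
have badl z : z \in Z -> (y, z) \in bad.
  by move=> Zz; rewrite inE [X in X || _]imset_f.
have Zcom z : adj x z -> adj y z -> z \in Z by move=> xz yz; rewrite !inE xz yz orbT.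
have c2I : {in arcs G :\: bad &, injective c2}.
  move=> [u v] [u' v'] /setDP[uv nb] /setDP[uv' nb'] [/ceq cu /ceq cv].
  rewrite !inE /= in uv uv'.
  have nbr z : (z, y) \notin bad -> adj z x -> ~~ adj z y.
    by move=> nbz zx; apply: contra nbz => zy; apply/badr/Zcom; rewrite adj_sym.
  have nbl z : (y, z) \notin bad -> adj x z -> ~~ adj y z.
    by move=> nbz xz; apply: contra nbz => yz; apply/badl/Zcom.
  case: cu cv => [uu'|[ux u'y]|[uy u'x]] [vv'|[vx v'y]|[vy v'x]]; subst=> //.
  + by have := nbr _ nb' uv; rewrite uv'.
  + by have := nbr _ nb uv'; rewrite uv.
  + by have := nbl _ nb' uv; rewrite uv'.
  + by rewrite adj_irrefl in uv.
  + by rewrite badr in nb.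
  + by have := nbl _ nb uv'; rewrite uv.
  + by rewrite badl in nb.
  + by rewrite adj_irrefl in uv.
have sub : c2 @: (arcs G :\: bad) \subset arcs (quotient c).
  apply/subsetP => _ /imsetP[[u v] /setDP[uv nb] ->]; rewrite !inE /= in uv *.
  apply/andP; split; last by apply/existsP; exists u; apply/existsP; exists v; rewrite !eqxx.
  apply: contraNneq nb => /ceq[uv'|[-> ->]|[-> ->]]; last exact: badl.
    by rewrite uv' adj_irrefl in uv.
  exact: badr.
have := subset_leq_card sub; rewrite card_in_imset // => le1.
rewrite -(cardsID bad (arcs G)) addnC leq_add // (leq_trans _ le_bad) //.
by rewrite subset_leq_card ?subsetIr.
Qed.

Definition complete_graph (r : nat) : sgraph :=
  @SGraph 'I_r (fun i j => i != j) (fun i j => congr1 negb (eq_sym i j))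
    (fun i => congr1 negb (eqxx i)).

(** The set [[set x]] serves as the extra branch set, since all others lie in the neighborhood of
    [x]. *)
Lemma clique_minor_neighborhood (G : sgraph) (x : G) (r : nat) :
  is_minor (complete_graph r) (induced [set y | adj x y]) ->
  is_minor (complete_graph r.+1) G.
Proof.
set N := [set y | adj x y]; move=> /is_minorP[B [cB dB aB]]; apply/is_minorP.
pose D j : {set G} := [set val u | u in B j].
have DN j u : u \in D j -> adj x u.
  by move=> /imsetP[v _ ->]; have := valP v; rewrite inE.
have nDx j : x \notin D j by apply/negP => /DN; rewrite adj_irrefl.
have aD j : exists2 u, u \in D j & adj x u.
  have [u Bu _] := cB j; exists (val u); [exact: imset_f | apply: (DN j); exact: imset_f].
exists (fun i : complete_graph r.+1 => if unlift ord0 i is Some j then D j else [set x]); split.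
- move=> i; case: unliftP => [j _|_]; last exact: connected_set1.
  by apply: (@connected_set_imset (induced N)).
- move=> i i'; case: unliftP => [j ->|->]; case: unliftP => [j' ->|->]; rewrite ?eqxx //.
  + rewrite (inj_eq lift_inj) => /dB dj.
    rewrite -setI_eq0 -imsetI; last by move=> ? ? _ _ /val_inj.
    by rewrite (disjoint_setI0 dj) imset0.
  + by rewrite disjoint_sym disjoints1.
  + by rewrite disjoints1.
- move=> i i'; case: unliftP => [j ->|->]; case: unliftP => [j' ->|->]; rewrite /= ?eqxx //.
  + rewrite (inj_eq lift_inj) => /aB[u [v [Bu Bv uv]]].
    by exists (val u), (val v); split=> //; apply: imset_f.
  + by have [u Du xu] := aD j; exists u, x; rewrite set11 adj_sym.
  + by have [u Du xu] := aD j'; exists x, u; rewrite set11.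
Qed.

(* Mader: contract an edge with few common neighbors; if there is none, some
   neighborhood induces a graph that is dense enough for the induction on [r]. *)
Lemma clique_minor_of_dense (r : nat) (G : sgraph) :
  0 < #|G| -> 2 ^ r * #|G| <= #|arcs G| -> is_minor (complete_graph r) G.
Proof.
elim: r G => [|r IHr] G; first by exists (fun=> set0); split=> -[].
have [n] := ubnP #|G|; elim: n G => // n IHn G leGn G_gt0 dense.
case: (boolP [exists x : G, exists y, adj x y && (#|common_neighbors x y| < 2 ^ r)]).
  move=> /existsP[x /existsP[y /andP[xy few]]].
  have [K [minK K_gt0 cardG leK]] := contract_edge xy.
  apply: is_minor_trans minK; apply: IHn => //; first by rewrite cardG in leGn.
  (* The contraction loses at most [2 * 2 ^ r = 2 ^ r.+1] arcs, exactly the share of the lost vertex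
     in the density bound. *)
  rewrite cardG in dense; rewrite expnS in dense *; nia.
move=> many; have [x [y xy]] : exists x : G, exists y, adj x y.
  have /card_gt0P[[x y]] : 0 < #|arcs G|.
    by apply: leq_trans dense; rewrite muln_gt0 expn_gt0.
  by rewrite inE; exists x, y.
apply: (@clique_minor_neighborhood _ x); apply: IHr.
  by rewrite card_sig; apply/card_gt0P; exists y; rewrite !inE.
(* Inside the neighborhood of [x], the degree of [z] is its number of common neighbors with [x],
   hence at least [2 ^ r]; summing gives the density required for [r]. *)
rewrite card_arcs mulnC -sum_nat_const; apply: leq_sum => z _.
have xz : adj x (val z) by have := valP z; rewrite inE.
have -> : degree z = #|common_neighbors x (val z)|.
  rewrite /degree -(card_imset _ val_inj); apply: eq_card => u; rewrite inE.
  apply/imsetP/andP => [[v] | [xu zu]].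
    by rewrite inE => zv ->; have := valP v; rewrite inE.
  have Nu : u \in [set y | adj x y] by rewrite inE.
  by exists (exist _ u Nu); rewrite ?inE.
rewrite leqNgt; apply: contra many => few.
by apply/existsP; exists x; apply/existsP; exists (val z); rewrite xz.
Qed.

Lemma bipartite_minor_clique (a b : nat) :
  is_minor (complete_bipartite a b) (complete_graph (a + b)).
Proof.
apply/is_minorP; exists (fun v => [set unsplit v]); split=> [v|u v uv|u v uv].
- exact: connected_set1.
- by rewrite disjoints1 inE (inj_eq (can_inj (@unsplitK a b))).
exists (unsplit u), (unsplit v); rewrite !set11; split=> //=.
by rewrite (inj_eq (can_inj (@unsplitK a b))); case: u v uv => [i|i] [j|j].
Qed.

(** * The lower bound *)

Section RootedTree.
Variables (D : finType) (root : D) (par : D -> D) (rk : D -> nat).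
Hypothesis rk_par : forall d, d != root -> rk (par d) < rk d.

Definition rooted_adj : rel D :=
  fun d e => (d != root) && (par d == e) || (e != root) && (par e == d).

Lemma rooted_sym : symmetric rooted_adj.
Proof. by move=> d e; rewrite /rooted_adj orbC. Qed.

Lemma rooted_irrefl : irreflexive rooted_adj.
Proof.
move=> d; rewrite /rooted_adj orbb; apply/negP => /andP[/rk_par lt /eqP dE].
by rewrite dE ltnn in lt.
Qed.

Definition rooted_tree : sgraph := SGraph rooted_sym rooted_irrefl.

(** Following parents from a vertex of [A] stays in [A] until [top] is reached, which must happen
    because ranks drop. *)
Lemma rooted_connected (A : {set rooted_tree}) (top : D) :
  top \in A -> (forall d, d \in A -> d != top -> d != root /\ par d \in A) ->
  connected_set A.
Proof.
move=> Atop parA; exists top => // d; have [n] := ubnP (rk d).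
elim: n d => // n IHn d ltn Ad; have [->//|dtop] := eqVneq d top.
have [droot Apar] := parA d Ad dtop.
apply: connect_trans (IHn _ (leq_trans (rk_par droot) ltn) Apar) (connect1 _).
by apply/and3P; rewrite /= /rooted_adj droot eqxx orbT.
Qed.

(** On a cycle, both neighbors of a vertex of maximal rank would be its parent, hence equal. *)
Lemma rooted_tree_is_tree : is_tree rooted_tree.
Proof.
split.
  have /connected_setP[_ cT] : connected_set [set: rooted_tree].
    by apply: (@rooted_connected _ root); rewrite // => d _ ->; rewrite inE.
  split=> [|x y]; first by apply/card_gt0P; exists root.
  by apply: sub_connect (cT x y (in_setT _) (in_setT _)) => u v /and3P[].
move=> c /andP[cyc_c uc]; rewrite ltnNge; apply/negP => lt2.
have [x cx max_x] : exists2 x, x \in c & forall y, y \in c -> rk y <= rk x.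
  have [x0 cx0] : exists x, x \in c.
    by case: c lt2 {cyc_c uc} => // x c _; exists x; rewrite mem_head.
  by case: (arg_maxnP rk cx0) => x cx max_x; exists x.
have up y : y \in c -> rooted_adj x y -> par x = y.
  move=> cy /orP[/andP[_ /eqP] //|/andP[/rk_par lt /eqP yE]].
  by have := max_x y cy; rewrite -yE leqNgt lt.
have [i c' cE] := rot_to cx.
move: cyc_c uc lt2; rewrite -(rot_cycle i) -(rot_uniq i) -(size_rot i) cE.
have mem y : y \in c' -> y \in c by move=> c'y; rewrite -(mem_rot i) cE inE c'y orbT.
case: c' mem {cE} => [|y c'] mem //=; case: c' mem => [|z c'] mem //=.
rewrite rcons_path => /and3P[/= xy _ /andP[_ lastx]] /and4P[_ y_notin _ _] _.
have parxy := up y (mem y (mem_head _ _)) xy.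
have cl : last z c' \in c by apply: mem; rewrite inE mem_last orbT.
have := up _ cl; rewrite rooted_sym parxy => /(_ lastx) yE.
by rewrite yE mem_last in y_notin.
Qed.

End RootedTree.

Section BlowUp.
(* A graph whose vertices are labelled by vertices of [T] ([None] for isolated
   vertices) and inherit the adjacency of their labels; [base] marks one vertex
   for each label. *)
Variables (T : sgraph) (V : finType) (label : V -> option T) (base : T -> V).

Definition blowup_adj : rel V :=
  fun x y => if (label x, label y) is (Some u, Some v) then adj u v else false.

Lemma blowup_sym : symmetric blowup_adj.
Proof.
move=> x y; rewrite /blowup_adj.
by case: (label x) (label y) => [u|] [v|] //; apply: adj_sym.
Qed.

Lemma blowup_irrefl : irreflexive blowup_adj.
Proof. by move=> x; rewrite /blowup_adj; case: (label x) => // u; apply: adj_irrefl. Qed.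

Definition blowup : sgraph := SGraph blowup_sym blowup_irrefl.

Hypothesis label_base : forall v, label (base v) = Some v.

(** Choosing one vertex of each label yields a copy of [T]. The labels recover the choice from the
    vertex set of the copy, so automorphisms of [T] cause no overcounting. *)
Lemma prod_fibers_le_copies :
  \prod_(v : T) #|[set x | label x == Some v]| <= copies T blowup.
Proof.
pose F v := mem [set x : V | label x == Some v].
have -> : \prod_(v : T) #|[set x | label x == Some v]| =
    #|[set f : {ffun T -> blowup} | f \in family F]|.
  rewrite cardsE card_family foldrE big_map big_enum /=.
  by apply: eq_bigr => v _; apply: eq_card => x; rewrite inE.
have labelF f v : f \in [set f : {ffun T -> blowup} | f \in family F] -> label (f v) = Some v.
  by rewrite inE => /familyP/(_ v); rewrite !inE => /eqP.
rewrite -(card_in_imset (f := @image_subgraph T blowup)).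
  apply/subset_leq_card/subsetP => _ /imsetP[f /labelF fF ->].
  have [||sub iso] := @image_subgraph_copy T blowup f.
  - by move=> u v fuv; apply: Some_inj; rewrite -!fF fuv.
  - by move=> u v; rewrite /= /blowup_adj !fF.
  by rewrite inE sub; apply/asboolP.
move=> f g /labelF fF /labelF gF [fg _]; apply/ffunP => v.
have : f v \in g @: [set: T] by rewrite -fg imset_f.
move=> /imsetP[u _ fE]; rewrite fE; congr (g _); apply: Some_inj.
by rewrite -gF -fF fE.
Qed.

Variables (S : {set T}) (s : nat).
Hypotheses (T_forest : is_forest T) (s_gt0 : 0 < s).
Hypotheses (S_stable : stable S) (S_low : S \subset low_vertices s T).
Hypothesis label_notin : forall x v, label x = Some v -> v \notin S -> x = base v.

(* With the forest rooted, the node of [base v] hangs below the node of the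
   parent of [v], and those of the other vertices labelled [v] below that of
   [base v]. *)
Lemma blowup_treewidth : treewidth_at_most blowup s.
Proof.
have [par [rk [parP adjP]]] := forest_parent T_forest.
(* The nodes are the vertices of the blow-up and an extra root [None], placed above the unlabelled
   vertices and the bases of the roots of the forest. *)
pose up (d : option V) : option V :=
  if d isn't Some x then None else
  if label x isn't Some v then None else
  if x == base v then omap base (par v) else Some (base v).
pose drk (d : option V) : nat :=
  if d isn't Some x then 0 else
  if label x isn't Some v then 1 else
  if x == base v then (rk v).+1 else (rk v).+2.
have up_rk d : d != None -> drk (up d) < drk d.
  case: d => // x _; rewrite /up /drk; case: (label x) => // v.
  case: (x =P base v) => _; last by rewrite label_base eqxx.
  case parv: (par v) => [u|] //=; rewrite label_base eqxx.
  by have [_] := parP _ _ parv; rewrite ltnS.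
(* Besides its own vertex, a bag holds only bases of vertices outside [S]: of all neighbors if [v]
   is in [S], and otherwise of at most the parent. As [S] is stable, each edge is covered by the bag
   of its end labelled in [S] or, if there is none, of its child end. *)
pose nbr v : {set T} :=
  if v \in S then [set u | adj v u] else [set u | (par v == Some u) && (u \notin S)].
pose bag (d : option V) : {set V} :=
  if d isn't Some x then set0 else
  x |: (if label x is Some v then base @: nbr v else set0).
have base_inj : injective base by move=> u v uv; apply: Some_inj; rewrite -!label_base uv.
have nbrS v u : u \in nbr v -> adj v u /\ u \notin S.
  rewrite /nbr; case: ifP => Sv; rewrite inE; last by case/andP => /eqP/parP[].
  by move=> vu; split=> //; apply: contraL vu => Su; apply: (stableP _ S_stable).
have bagP x d : x \in bag d -> d = Some x \/
    exists y v u, [/\ d = Some y, label y = Some v, u \in nbr v & x = base u].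
  case: d => [y|]; rewrite ?inE // => /orP[/eqP-> | ]; first by left.
  case ly: (label y) => [v|]; rewrite ?inE // => /imsetP[u nu ->].
  by right; exists y, v, u.
pose D := rooted_tree up_rk.
exists D, bag; split.
  split.
  - exact: rooted_tree_is_tree.
  - move=> x; apply/is_connected_induced.
    (* The highest node whose bag contains [x] is that of [x], unless the label of [x] is outside
       [S] and has its parent [v] in [S]; then it is the node of [base v]. *)
    pose top := if label x is Some u then
        if par u is Some v then if (u \notin S) && (v \in S) then Some (base v) else Some x
        else Some x
      else Some x.
    apply: (@rooted_connected _ _ _ _ up_rk _ top).
      rewrite inE /top; case lx: (label x) => [u|]; last exact: setU11.
      case pu: (par u) => [v|]; last exact: setU11.
      case: ifP => [/andP[Su Sv]|_]; last exact: setU11.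
      rewrite (label_notin lx Su) /bag label_base /nbr Sv inE imset_f ?orbT // inE adj_sym.
      by have [] := parP _ _ pu.
    move=> d; rewrite inE => xd dtop.
    have d_root : d != None by apply: contraTneq xd => ->; rewrite inE.
    split=> //; rewrite inE; have [dE|[y [v [u [dE ly nu xE]]]]] := bagP _ _ xd.
      move: dtop; rewrite dE /top /up; case lx: (label x) => [u|]; rewrite ?eqxx //.
      case pu: (par u) => [v|]; rewrite ?eqxx //.
      case: ifP => [/andP[Su Sv] _|]; last by rewrite eqxx.
      rewrite (label_notin lx Su) eqxx /= /bag label_base /nbr Sv.
      by rewrite inE imset_f ?orbT // inE adj_sym; have [] := parP _ _ pu.
    have [vu Su] := nbrS _ _ nu; rewrite dE /up ly.
    case: (y =P base v) => [yE|_]; last by rewrite /bag label_base xE inE imset_f ?orbT.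
    have [pv|pu] := adjP _ _ vu; first by rewrite pv /= xE setU11.
    move: dtop; rewrite dE yE /top xE label_base pu Su /=.
    move: nu; rewrite /nbr; case: ifP => _; first by rewrite eqxx.
    by rewrite inE => /andP[/eqP pv _] _; rewrite pv /= setU11.
  - have half x y u v : label x = Some u -> label y = Some v -> v \in nbr u ->
        exists d : D, (x \in bag d) && (y \in bag d).
      move=> lx ly nv; exists (Some x); rewrite setU11 (label_notin ly); last by case/nbrS: nv.
      by rewrite /bag lx inE imset_f ?orbT.
    have swap x y : (exists d : D, (x \in bag d) && (y \in bag d)) ->
        exists d : D, (y \in bag d) && (x \in bag d).
      by case=> d; exists d; rewrite andbC.
    move=> x y; rewrite /= /blowup_adj; case lx: (label x) => [u|] //.
    case ly: (label y) => [v|] // uv.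
    case: (boolP (u \in S)) => Su.
      by apply: (half x y u v) => //; rewrite /nbr Su inE.
    case: (boolP (v \in S)) => Sv.
      by apply/swap/(half y x v u) => //; rewrite /nbr Sv inE adj_sym.
    have [pu|pv] := adjP _ _ uv.
      by apply: (half x y u v) => //; rewrite /nbr (negPf Su) inE pu eqxx.
    by apply/swap/(half y x v u) => //; rewrite /nbr (negPf Sv) inE pv eqxx.
case=> [x|]; last by rewrite /bag cards0.
rewrite /bag; apply: leq_trans (leq_card_setU _ _).1 _; rewrite cards1 add1n ltnS.
case: (label x) => [v|]; last by rewrite cards0.
apply: leq_trans (leq_imset_card _ _) _; rewrite /nbr; case: ifP => [/(subsetP S_low)|_].
  by rewrite inE.
(* The single parent fits into the bag because [s > 0]. *)
apply: leq_trans s_gt0; case: (par v) => [w|]; last first.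
  by rewrite (_ : [set _ | _] = set0) ?cards0 //; apply/setP => u; rewrite !inE.
rewrite -(cards1 w); apply/subset_leq_card/subsetP => u; rewrite !inE => /andP[/eqP[->] _].
exact: eqxx.
Qed.

End BlowUp.

Lemma blowup_lower_bound (C : graph_class) (s : nat) (T : sgraph) :
  0 < s -> is_forest T -> (forall G, treewidth_at_most G s -> C G) ->
  forall q r, exists G : sgraph,
    [/\ C G, #|G| = #|T| + alpha_low s T * q + r & q.+1 ^ alpha_low s T <= copies T G].
Proof.
move=> s_gt0 T_forest C_tw q r; have [S [lowS stS cardS]] := alpha_low_witness s T.
(* Each vertex of [S] gets [q] twins, hence [q.+1] choices together with its base; [r] isolated
   vertices adjust the order of the graph. *)
pose V : finType := (T + {x : T | x \in S} * 'I_q + 'I_r)%type.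
pose label (x : V) : option T := match x with
  | inl (inl v) => Some v | inl (inr (v, _)) => Some (val v) | inr _ => None end.
pose base (v : T) : V := inl (inl v).
exists (blowup label); split.
- apply/C_tw/(@blowup_treewidth _ _ _ base _ S) => // -[[v|[v i]]|i] u //= [<-] //.
  by rewrite (valP v).
- by rewrite !card_sum card_prod !card_ord card_sig cardS.
apply: leq_trans (prod_fibers_le_copies label).
rewrite -cardS -prod_nat_const big_mkcond /=.
apply: leq_prod => v _; case: ifP => Sv; last first.
  by apply/card_gt0P; exists (base v); rewrite inE.
pose f (i : option 'I_q) : V := if i is Some i then inl (inr (exist _ v Sv, i)) else base v.
have fI : injective f by move=> [i|] [j|] //= [->].
rewrite -[q in q.+1]card_ord -card_option -(card_imset _ fI).
by apply/subset_leq_card/subsetP => _ /imsetP[[i|] _ ->]; rewrite inE.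
Qed.

(** * Growth of the maximum number of copies *)

From mathcomp Require Import all_order all_algebra.
From mathcomp Require Import classical_sets reals topology normedtype.
From mathcomp Require Import landau.

Lemma max_copies_upper (s t : nat) (C : graph_class) (T : sgraph) :
  0 < s -> 0 < t -> is_forest T ->
  (forall G H, C G -> is_minor H G -> C H) -> ~ C (complete_bipartite s.+1 t) ->
  exists c, forall n, 0 < n -> max_copies T C n <= c * n ^ alpha_low s T.
Proof.
move=> s_gt0 t_gt0 T_forest C_minor C_Kst.
have [N leN] := card_embeddings_le T_forest s_gt0 t_gt0.
(* Without a clique minor of order [s.+1 + t], [G] has at most [2 ^ (s.+1 + t) * n] arcs; the
   successor accounts for its [n] vertices. *)
exists ((2 ^ (s.+1 + t)).+1 ^ alpha_low s T * N) => n n_gt0; rewrite /max_copies.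
(* If no maximum exists, [max_copies] takes its default value 0. *)
case: xgetP => [m _ [[G [CG cardG <-]] _]|_] //.
have no_minor : ~ is_minor (complete_bipartite s.+1 t) G by move=> /(C_minor _ _ CG).
have sparse : #|arcs G| <= 2 ^ (s.+1 + t) * n.
  rewrite leqNgt -cardG; apply/negP => dense; apply: no_minor.
  apply: is_minor_trans (bipartite_minor_clique _ _) _.
  by apply: clique_minor_of_dense; rewrite ?cardG // ltnW // -cardG.
apply: leq_trans (copies_le_embeddings T G) _.
apply: leq_trans (leN G _ no_minor) _; first by rewrite cardG.
rewrite mulnAC leq_mul2r -expnMn; apply/orP; right.
have [->|a_gt0] := posnP (alpha_low s T); first by rewrite !expn0.
by rewrite leq_exp2r // mulSn cardG leq_add2l.
Qed.

Lemma max_copies_lower (s : nat) (C : graph_class) (T : sgraph) :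
  0 < s -> is_forest T -> (forall G, treewidth_at_most G s -> C G) ->
  exists2 c, 0 < c &
    forall n, 2 * #|T| <= n -> n ^ alpha_low s T <= c * max_copies T C n.
Proof.
move=> s_gt0 T_forest C_treewidth; set a := alpha_low s T.
(* As [n - #|T|] is at least half of [n] and less than [a * q.+1] for [a > 0], one gets
   [n <= 2 * a * q.+1]. For [a = 0] the constant is 1. *)
exists ((2 * a) ^ a) => [|n len]; first by case: a => // a; rewrite expn_gt0.
pose q := (n - #|T|) %/ a.
have leq : a * q <= n - #|T| by rewrite mulnC leq_divM.
have [G [CG cardG le_copies]] :=
  blowup_lower_bound s_gt0 T_forest C_treewidth q (n - #|T| - a * q).
have {}cardG : #|G| = n.
  by rewrite cardG -/a -addnA subnKC // subnKC //; move: len; lia.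
have [_ /(_ G CG cardG) le_max] := max_copiesP T (ex_intro2 _ _ G CG cardG).
apply: leq_trans (leq_mul (leqnn _) (leq_trans le_copies le_max)).
rewrite -/a -expnMn; have [->|a_gt0] := posnP a; first by rewrite !expn0.
rewrite leq_exp2r //; have := ltn_ceil (n - #|T|) a_gt0; rewrite -/q; nia.
Qed.

Import Order.TTheory GRing.Theory Num.Theory.
Import numFieldNormedType.Exports.
Local Open Scope classical_set_scope.
Local Open Scope ring_scope.

Theorem theorem2 (R : realType) (s t : nat) (s_gt0 : (0 < s)%N) (t_gt0 : (0 < t)%N)
    (C : graph_class) (C_minor_closed : minor_closed C)
    (C_treewidth : forall G : sgraph, treewidth_at_most G s -> C G)
    (C_Kst : ~ C (complete_bipartite s.+1 t))
    (T : sgraph) (T_forest : is_forest T) :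
  (fun n : nat => (max_copies T C n)%:R : R)
    \is 'Theta_\oo (fun n : nat => n%:R ^+ alpha_low s T : R).
Proof.
have C_minor := C_minor_closed.2.
have [c upper] := max_copies_upper s_gt0 t_gt0 T_forest C_minor C_Kst.
have [k k_gt0 lower] := max_copies_lower s_gt0 T_forest C_treewidth.
(* The constants must be positive, whereas [c] may be 0. *)
apply/asboolP; exists (k%:R^-1, c.+1%:R).
  by rewrite /= invr_gt0 !ltr0n k_gt0.
(* The threshold gives both [2 * #|T| <= n] for the lower bound and [0 < n] for the upper bound. *)
exists (2 * #|T| + 1)%N => // n /= len.
rewrite -natrX !normr_nat /= -natrM ler_nat; split.
  rewrite ler_pdivrMl ?ltr0n // -natrM ler_nat lower //.
  by apply: leq_trans len; rewrite leq_addr.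
apply: leq_trans (upper n _) _; last by rewrite leq_mul2r leqnSn orbT.
by apply: leq_trans len; rewrite addn1.
Qed.
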